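(* Let $F:\mathbb{T}^n\to\mathbb{T}^n$ be the Shapley operator of a stochastic mean payoff game. Suppose that all the initial states $k\in[n]$ of the game have the same value $\lambda$, and that $\lambda\neq0$. Then, for all choices of $\varepsilon>0$, the procedure CheckFeasibility applied to $(F,\varepsilon)$ terminates and is correct. That is: it stops after finitely many iterations; if it stops with $\max_k u_k\le-\varepsilon$, then there is no vector $x\in\mathbb{T}^n$, $x\neq(-\infty,\dots,-\infty)$, such that $x\le F(x)$; and otherwise the vector $v\in\mathbb{R}^n$ computed by the procedure satisfies $v\le F(v)$.
   Context: Procedure CheckFeasibility$(F,\varepsilon)$ (in exact arithmetic): initialize $u:=0\in\mathbb{R}^n$ and $v:=0\in\mathbb{R}^n$. While $\max_k u_k>-\varepsilon$ and $\min_k u_k<\varepsilon$, do: $v:=\max(v,u)$ (entrywise), then $u:=F(u)$. When the loop exits: if $\max_k u_k\le-\varepsilon$, report that there is no $x\in\mathbb{T}^n$, $x\ne(-\infty,\dots,-\infty)$, with $x\le F(x)$; otherwise report that $v$ satisfies $v\le F(v)$. $\mathbb{T}=\mathbb{R}\cup\{-\infty\}$, $\frac12(-\infty)=-\infty$, and $\le$ on $\mathbb{T}^n$ is entrywise. A stochastic mean payoff game has states $[n]$ of Player Min and $[m]$ of Player Max. For each $k\in[n]$ there is a nonempty set $A^{(k)}$ of actions, each a subset of $[m]$ of cardinality $1$ or $2$; for each $i\in[m]$ a nonempty set $B^{(i)}$ of actions, each a singleton of $[n]$; real payments $r^a_k$ ($a\in A^{(k)}$), $r^b_i$ ($b\in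 B^{(i)}$). From $k$, Min picks $a\in A^{(k)}$, pays $r_k^a$ to Max, and the pawn moves to an element of $a$ chosen uniformly at random; from $i$, Max picks $b=\{l\}\in B^{(i)}$, receives $r_i^b$ and the pawn moves to $l$. Policies are maps $\sigma:k\mapsto\sigma(k)\in A^{(k)}$, $\tau:i\mapsto\tau(i)\in B^{(i)}$; the payoff is $g_k(\sigma,\tau)=\lim_{N\to\infty}\mathbb{E}_{\sigma,\tau}\bigl(\frac{1}{2N}\sum_{p=1}^N(r^{\sigma(k_p)}_{k_p}+r^{\tau(i_p)}_{i_p})\bigr)$ over trajectories $k_1=k,i_1,k_2,i_2,\dots$. It is known that there exist policies $(\overline\sigma,\overline\tau)$ and a unique $\chi\in\mathbb{R}^n$ (the value; $\chi_k$ is the value of initial state $k$) with $g_k(\overline\sigma,\tau)\le\chi_k\le g_k(\sigma,\overline\tau)$ for all $k,\sigma,\tau$. The Shapley operator is $$(F(x))_k=\min_{a=\{i,j\}\in A^{(k)}}\Bigl(r^a_k+\tfrac12\bigl(\max_{b=\{l\}\in B^{(i)}}(r^b_i+x_l)+\max_{b=\{l\}\in B^{(j)}}(r^b_j+x_l)\bigr)\Bigr),$$ with $i=j$ when $a=\{i\}$ is a singleton. *)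

(* Defs.v *)
From HB Require Import structures.
From mathcomp Require Import all_boot all_order all_algebra.
From mathcomp Require Import all_classical all_reals all_analysis.

Set Implicit Arguments.
Unset Strict Implicit.
Unset Printing Implicit Defensive.

Import Order.TTheory GRing.Theory Num.Theory.
Import numFieldNormedType.Exports.

Local Open Scope ring_scope.
Local Open Scope classical_set_scope.

(* The states of Min are 'I_n, those of Max are 'I_m. The payments are total
   functions, but only their values at available actions are ever used. *)
Record game (R : realType) (n m : nat) := Game {
  minA : 'I_n -> {set {set 'I_m}};
  maxB : 'I_m -> {set {set 'I_n}};
  minr : 'I_n -> {set 'I_m} -> R;
  maxr : 'I_m -> {set 'I_n} -> R;
  minA_neq0 : forall k, minA k != finset.set0;
  minA_card : forall k a, a \in minA k -> #|a| = 1%N \/ #|a| = 2%N;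
  maxB_neq0 : forall i, maxB i != finset.set0;
  maxB_card : forall i b, b \in maxB i -> #|b| = 1%N }.

Section Payoff.
Context {R : realType} {n m : nat} (G : game R n m).

Definition min_policy (sigma : 'I_n -> {set 'I_m}) : Prop :=
  forall k, sigma k \in minA G k.

Definition max_policy (tau : 'I_m -> {set 'I_n}) : Prop :=
  forall i, tau i \in maxB G i.

Section Trajectories.
Variables (sigma : 'I_n -> {set 'I_m}) (tau : 'I_m -> {set 'I_n}).

(* A trajectory of N turns is k_1, i_1, ..., k_N, i_N, k_(N+1); with indices
   shifted to start at 0, [ks] lists the k_p and [js] the i_p. Turn p goes from
   [ks (turn p)] through [js p] to [ks (lift ord0 p)], whose index is p + 1. *)
Definition turn N (p : 'I_N) : 'I_N.+1 := widen_ord (leqnSn N) p.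

Definition traj_prob (k : 'I_n) N (ks : {ffun 'I_N.+1 -> 'I_n})
    (js : {ffun 'I_N -> 'I_m}) : R :=
  (ks ord0 == k)%:R *
  \prod_(p < N)
    ((js p \in sigma (ks (turn p)))%:R / #|sigma (ks (turn p))|%:R *
     (tau (js p) == [set ks (lift ord0 p)]%SET)%:R).

Definition traj_payment N (ks : {ffun 'I_N.+1 -> 'I_n})
    (js : {ffun 'I_N -> 'I_m}) : R :=
  \sum_(p < N) (minr G (ks (turn p)) (sigma (ks (turn p))) +
                maxr G (js p) (tau (js p))).

Definition mean_payment (k : 'I_n) (N : nat) : R :=
  \sum_(ks : {ffun 'I_N.+1 -> 'I_n}) \sum_(js : {ffun 'I_N -> 'I_m})
    traj_prob k ks js * ((2 * N%:R)^-1 * traj_payment ks js).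

Definition payoff (k : 'I_n) : R := lim (mean_payment k N @[N --> \oo]).

End Trajectories.

Definition is_value (chi : 'I_n -> R) : Prop :=
  exists sigma' tau', [/\ min_policy sigma', max_policy tau' &
    forall k sigma tau, min_policy sigma -> max_policy tau ->
      payoff sigma' tau k <= chi k /\ chi k <= payoff sigma tau' k].

End Payoff.

(* Vectors of T^n, where T = R U {-oo}, are functions 'I_n -> \bar R that never
   take the value +oo. *)
Definition in_Tn {R : realType} {n : nat} (x : 'I_n -> \bar R) : Prop :=
  forall k, x k != +oo%E.

Definition shapley {R : realType} {n m : nat} (G : game R n m)
    (x : 'I_n -> \bar R) : 'I_n -> \bar R :=
  let best i := \big[Order.max/-oo%E]_(l < n | [set l]%SET \in maxB G i)
                  ((maxr G i [set l]%SET)%:E + x l)%E in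
  (* i and j may coincide, [set i; i] being the singleton [set i] *)
  fun k => \big[Order.min/+oo%E]_(ij : 'I_m * 'I_m |
                                  [set ij.1; ij.2]%SET \in minA G k)
    ((minr G k [set ij.1; ij.2]%SET)%:E +
     (2^-1)%:E * (best ij.1 + best ij.2))%E.

(* [while guard body s s']: started in state s, the loop stops after finitely
   many iterations, in state s'. *)
Inductive while (S : Type) (guard : S -> bool) (body : S -> S) : S -> S -> Prop :=
| while_stop s : ~~ guard s -> while guard body s s
| while_next s s' : guard s -> while guard body (body s) s' ->
    while guard body s s'.

Section CheckFeasibility.
Context {R : realType} {n : nat}.

Definition vmax (u : 'I_n -> \bar R) : \bar R :=
  \big[Order.max/-oo%E]_(k < n) u k.

Definition vmin (u : 'I_n -> \bar R) : \bar R :=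
  \big[Order.min/+oo%E]_(k < n) u k.

(* The state of the loop is the pair (u, v). *)
Definition CheckFeasibility (F : ('I_n -> \bar R) -> ('I_n -> \bar R)) (eps : R)
    : ('I_n -> \bar R) * ('I_n -> \bar R) -> Prop :=
  while (fun uv : ('I_n -> \bar R) * ('I_n -> \bar R) =>
           ((- eps)%:E < vmax uv.1)%E && (vmin uv.1 < eps%:E)%E)
        (fun uv => (F uv.1, fun k => Order.max (uv.2 k) (uv.1 k) : \bar R))
        (fun=> 0%E, fun=> 0%E).

End CheckFeasibility.

(* Main.v *)
Require Import Defs.
From HB Require Import structures.
From mathcomp Require Import all_boot all_order all_algebra.
From mathcomp Require Import all_classical all_reals all_analysis.
From mathcomp Require Import ring lra.

Set Implicit Arguments.
Unset Strict Implicit.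
Unset Printing Implicit Defensive.

Import Order.TTheory GRing.Theory Num.Theory.
Import numFieldNormedType.Exports.

Local Open Scope ring_scope.

(* Fix an optimal policy of one player, so that every stationary policy p of
   the other gives a Markov chain with transition matrix P and payments r. Since
   P is nonexpansive, ker (I - P) and im (I - P) are complementary, whence
   r = a + b - P b with P a = a, and a / 2 is the payoff of p. When a >= g > 0
   for all p, the optimal vector x of the problem discounted by a factor alpha
   close to 1 satisfies (1 - alpha) x >= g / 2, so that y = alpha x is a strict
   subsolution: F y >= y + g / 2. As F is monotone and commutes with the
   addition of constants, the orbit of 0 then drifts to +oo, and symmetrically
   to -oo when lambda < 0, so that the loop terminates.
   If u = F^N(0) <= -eps and x <= F(x) has finite maximum M, then
   x <= F^N(x) <= F^N(0) + M <= M - eps, a contradiction. If u >= eps, the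
   maximum v of the iterates before u satisfies F(v) >= max(v, u). *)

(** * Stochastic matrices *)

Definition stochastic (R : realType) n (P : 'M[R]_n) : Prop :=
  (forall k l, 0 <= P k l) /\ (forall k, \sum_l P k l = 1).

Section Stochastic.
Context {R : realType} {n : nat} (P : 'M[R]_n).
Hypothesis sP : stochastic P.

Lemma stochastic_mul_le (x : 'cV[R]_n) C :
  (forall k, x k 0 <= C) -> forall k, (P *m x) k 0 <= C.
Proof.
move=> xC k; rewrite mxE -[C]mul1r -(sP.2 k) mulr_suml.
by apply: ler_sum => l _; rewrite ler_wpM2l // sP.1.
Qed.

Lemma stochastic_mul_norm (x : 'cV[R]_n) C :
  (forall k, `|x k 0| <= C) -> forall k, `|(P *m x) k 0| <= C.
Proof.
move=> xC k; rewrite ler_norml; apply/andP; split.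
  rewrite lerNl; have -> : - (P *m x) k 0 = (P *m - x) k 0 by rewrite mulmxN !mxE.
  apply: stochastic_mul_le => l; rewrite mxE lerNl.
  by have := xC l; rewrite ler_norml => /andP[].
by apply: stochastic_mul_le => l; have := xC l; rewrite ler_norml => /andP[].
Qed.

Lemma stochastic_iter_norm (x : 'cV[R]_n) C N :
  (forall k, `|x k 0| <= C) -> forall k, `|iter N (mulmx P) x k 0| <= C.
Proof.
by move=> xC; elim: N => [//|N IH] k; rewrite iterS; apply: stochastic_mul_norm.
Qed.

Lemma col_normW (x : 'cV[R]_n) k : `|x k 0| <= \sum_l `|x l 0|.
Proof. by rewrite (bigD1 k) //= lerDl sumr_ge0. Qed.

Lemma bounded_multiples_eq0 (c C : R) : (forall N, `|c *+ N| <= C) -> c = 0.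
Proof.
move=> cC; apply/eqP; apply: contraT => c0.
have cp : 0 < `|c| by rewrite normr_gt0.
have := cC (Num.truncn (C / `|c|)).+1; rewrite normrMn.
rewrite -mulr_natr -ler_pdivlMl // mulrC leNgt.
by rewrite truncnS_gt.
Qed.

(* If w = z - P z is fixed by P, then P^N z = z - N w stays bounded. *)
Lemma stochastic_ker2 (z : 'cV[R]_n) :
  P *m (z - P *m z) = z - P *m z -> P *m z = z.
Proof.
set w := z - P *m z => Pw.
have itE N : iter N (mulmx P) z = z - w *+ N.
  elim: N => [|N IH]; first by rewrite mulr0n subr0.
  rewrite iterS IH mulmxBr -scaler_nat -scalemxAr Pw scaler_nat mulrSr.
  by rewrite opprD addrA -[P *m z](subKr z) -/w; rewrite -!addrA [- w + _]addrC.
have w0 : w = 0.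
  apply/matrixP => k j; rewrite (ord1 j) [RHS]mxE.
  pose C := \sum_l `|z l 0|.
  apply: (@bounded_multiples_eq0 _ (C + C)) => N.
  have -> : w k 0 *+ N = z k 0 - iter N (mulmx P) z k 0.
    have subE (x y : 'cV[R]_n) : (x - y) k 0 = x k 0 - y k 0 by rewrite !mxE.
    by rewrite itE (subE z (w *+ N)) mulmxnE subKr.
  apply: le_trans (ler_normB _ _) _; apply: lerD; first exact: col_normW.
  by apply: stochastic_iter_norm => l; apply: col_normW.
by apply/esym/eqP; rewrite -subr_eq0 -/w w0.
Qed.

(** By [stochastic_ker2] the kernel and the image of [I - P] meet only in 0, so by a rank count they
    span the whole space. Here [a] is the mean payment per turn and [b] a bias vector. *)
Lemma ergodic_decomposition (r : 'cV[R]_n) :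
  exists a b : 'cV[R]_n, P *m a = a /\ r = a + b - P *m b.
Proof.
(* Transposed because [kermx] and row spaces concern row vectors. *)
pose M := (1%:M - P)^T.
have ME (x : 'cV[R]_n) : x^T *m M = (x - P *m x)^T.
  by rewrite /M -trmx_mul mulmxBl mul1mx.
have dis : (kermx M :&: M)%MS = 0.
  apply/eqP/rowV0P => u; rewrite sub_capmx => /andP[/sub_kermxP uM /submxP[w uE]].
  move: uM; rewrite uE -[w]trmxK ME ME => /(congr1 trmx); rewrite trmxK trmx0.
  move=> /eqP; rewrite subr_eq0 eq_sym => /eqP /stochastic_ker2 ->.
  by rewrite subrr trmx0.
have full : row_full (kermx M + M)%MS.
  rewrite /row_full mxrank_disjoint_sum // mxrank_ker subnK //.
  exact: rank_leq_row.
have /sub_addsmxP[[u v] /= rE] := submx_full (r^T) full.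
exists ((u *m kermx M)^T), (v^T); split.
  have : (u *m kermx M) *m M = 0 by rewrite -mulmxA mulmx_ker mulmx0.
  rewrite -[X in X *m M]trmxK ME => /(congr1 trmx); rewrite trmxK trmx0.
  by move=> /eqP; rewrite subr_eq0 eq_sym => /eqP.
by rewrite -[LHS]trmxK rE -[v in v *m M]trmxK ME linearD /= trmxK addrA.
Qed.

(** * Discounted equations for a fixed stochastic matrix *)

Section Discounted.
Variable alpha : R.
Hypotheses (a0 : 0 <= alpha) (a1 : alpha < 1).

(** At an index where [x] is largest the hypothesis gives [x k <= alpha * x k], which [alpha < 1]
    forbids for a positive entry. *)
Lemma discounted_max_principle (x : 'cV[R]_n) :
  (forall k, x k 0 <= alpha * (P *m x) k 0) -> forall k, x k 0 <= 0.
Proof.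
move=> xP k0; pose k := [arg max_(i > k0) x i 0]%O.
have kmax l : x l 0 <= x k 0 by rewrite /k; case: arg_maxP => // i _; apply.
apply: le_trans (kmax k0) _; rewrite leNgt; apply/negP => xk.
have := le_trans (xP k) (ler_wpM2l a0 (stochastic_mul_le kmax k)).
by rewrite leNgt -subr_gt0 -{1}[x k 0]mul1r -mulrBl pmulr_lgt0 // subr_gt0 a1.
Qed.

Lemma discounted_le (r x y : 'cV[R]_n) :
  (forall k, x k 0 <= (r + alpha *: (P *m x)) k 0) ->
  (forall k, (r + alpha *: (P *m y)) k 0 <= y k 0) ->
  forall k, x k 0 <= y k 0.
Proof.
move=> xr yr k; rewrite -subr_le0.
have -> : x k 0 - y k 0 = (x - y) k 0 by rewrite !mxE.
apply: discounted_max_principle => l.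
have := lerB (xr l) (yr l); rewrite mulmxBr !mxE.
set u := \sum_j _; set v := \sum_j _ => ?; lra.
Qed.

(** The maximum principle, applied to [x] and [- x], makes [I - alpha P] injective, hence
    invertible. *)
Lemma discounted_solution (r : 'cV[R]_n) :
  exists x : 'cV[R]_n, x = r + alpha *: (P *m x).
Proof.
have ker0 (x : 'cV[R]_n) : x = alpha *: (P *m x) -> x = 0.
  move=> xE; apply/matrixP => k j; rewrite (ord1 j) [RHS]mxE; apply/eqP.
  rewrite eq_le; apply/andP; split; last rewrite -oppr_le0.
    by apply: discounted_max_principle => l; rewrite {1}xE mxE.
  have -> : - x k 0 = (- x) k 0 by rewrite mxE.
  by apply: discounted_max_principle => l; rewrite {1}xE mulmxN !mxE mulrN.
have : (1%:M - alpha *: P)^T \in unitmx.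
  rewrite -row_free_unit; apply: inj_row_free => v.
  rewrite -[v]trmxK -trmx_mul => /(congr1 trmx); rewrite !trmxK trmx0.
  rewrite mulmxBl mul1mx -scalemxAl => /eqP; rewrite subr_eq0 => /eqP /ker0 v0.
  by rewrite -[v]trmxK v0 trmx0.
rewrite unitmx_tr => uP; exists (invmx (1%:M - alpha *: P) *m r).
have := mulKVmx uP r; rewrite mulmxBl mul1mx -scalemxAl => {2}<-.
by rewrite subrK.
Qed.
End Discounted.
End Stochastic.

(** * One-player games *)

(* Since w = a / (1 - alpha) + b - C is a subsolution of the discounted
   equation, the discounted value is at least w. *)
Lemma discounted_lower_bound (R : realType) n (P : 'M[R]_n) (r a b x : 'cV[R]_n)
    (alpha C : R) : stochastic P -> 0 <= alpha -> alpha < 1 ->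
  P *m a = a -> r = a + b - P *m b -> (forall k, `|b k 0| <= C) ->
  x = r + alpha *: (P *m x) ->
  forall k, a k 0 - 2 * C * (1 - alpha) <= (1 - alpha) * x k 0.
Proof.
move=> sP a0 a1 Pa rE bC xE k.
pose w : 'cV[R]_n := (1 - alpha)^-1 *: a + b - const_mx C.
have t0 : 0 < 1 - alpha by rewrite subr_gt0.
have PC : P *m const_mx C = const_mx C :> 'cV[R]_n.
  apply/matrixP => l j; rewrite !mxE -[RHS]mul1r -(sP.2 l) mulr_suml.
  by apply: eq_bigr => i _; rewrite mxE.
have wx : w k 0 <= x k 0.
  apply: (discounted_le sP a0 a1 (r := r)) => l; last by rewrite -xE.
  have Pb : (P *m b) l 0 <= C.
    apply: (stochastic_mul_le sP) => i.
    by have := bC i; rewrite ler_norml => /andP[].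
  rewrite /w mulmxBr mulmxDr -scalemxAr Pa PC rE.
  move: (P *m b) Pb => c cC; rewrite !mxE -subr_ge0.
  have aE : a l 0 = (1 - alpha) * ((1 - alpha)^-1 * a l 0).
    by rewrite mulrA mulfV ?mul1r // gt_eqF.
  move: aE; set q := (1 - alpha)^-1 * a l 0 => ->.
  (* With [c = P b], the gap [r + alpha P w - w] simplifies to exactly this product. *)
  have : 0 <= (1 - alpha) * (C - c l 0) by rewrite mulr_ge0 ?subr_ge0 // ltW.
  lra.
have bk := bC k; move: bk; rewrite ler_norml => /andP[bk _].
have := ler_wpM2l (ltW t0) wx; rewrite /w !mxE.
rewrite !mulrDr mulrA mulfV ?gt_eqF // mul1r.
have := ler_wpM2l (ltW t0) bk; lra.
Qed.

(** * Optimal policies of a one-player problem *)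

Section Optimality.
Context {R : realType} {n : nat} {Pi : finType} (ok : pred Pi).
Variables (r : Pi -> 'cV[R]_n) (P : Pi -> 'M[R]_n).
Hypothesis sP : forall p, ok p -> stochastic (P p).
(** One policy is best in all coordinates at once; in a game this holds because actions are chosen
    independently at each state. *)
Hypothesis greedy : forall y : 'cV[R]_n, exists2 p, ok p &
  forall q, ok q -> forall k, (r p + P p *m y) k 0 <= (r q + P q *m y) k 0.

(* A policy whose discounted costs have the smallest sum cannot be strictly
   improved by a greedy one. *)
Lemma discounted_optimality (alpha : R) : 0 <= alpha -> alpha < 1 ->
  exists p x, [/\ ok p, x = r p + alpha *: (P p *m x) &
    forall q, ok q -> forall k, x k 0 <= (r q + alpha *: (P q *m x)) k 0].
Proof.
move=> a0 a1.
have [X XE] : {X : Pi -> 'cV[R]_n &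
    forall p, ok p -> X p = r p + alpha *: (P p *m X p)}.
  apply: (@choice _ _ (fun p x => ok p -> x = r p + alpha *: (P p *m x))) => p.
  have [okp|] := boolP (ok p); last by exists 0.
  by have [x xE] := discounted_solution (sP okp) a0 a1 (r p); exists x.
have [p0 okp0 _] := greedy 0.
pose p := [arg min_(q < p0 | ok q) \sum_k X q k 0]%O.
have [okp pmin] : ok p /\ forall q, ok q -> \sum_k X p k 0 <= \sum_k X q k 0.
  by rewrite /p; case: arg_minP.
exists p, (X p); split=> //; first exact: XE.
have [q okq qmin] := greedy (alpha *: X p).
have Xq k : X q k 0 <= X p k 0.
  apply: (discounted_le (sP okq) a0 a1 (r := r q)) => l; first by rewrite -XE.
  rewrite scalemxAr; apply: le_trans (qmin _ okp l) _.
  by rewrite -scalemxAr -XE.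
have Xpq : X q = X p.
  apply/matrixP => k j; rewrite (ord1 j); apply/eqP; rewrite eq_le Xq /=.
  have := pmin _ okq; rewrite -subr_ge0 -sumrB leNgt => /negP.
  rewrite leNgt => ge0; apply/negP => lt; apply: ge0.
  rewrite (bigD1 k) //= -[ltRHS]addr0; apply: ltr_leD; first by rewrite subr_lt0.
  by apply: sumr_le0 => i _; rewrite subr_le0.
move=> q' okq' k; rewrite -{1}Xpq (XE _ okq) Xpq !scalemxAr.
exact: qmin.
Qed.

Lemma uniform_drift (g : R) : 0 < g ->
  (forall p, ok p -> forall a b : 'cV[R]_n,
     P p *m a = a -> r p = a + b - P p *m b -> forall k, g <= a k 0) ->
  exists y : 'cV[R]_n, forall q, ok q -> forall k,
    y k 0 + g / 2 <= (r q + P q *m y) k 0.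
Proof.
move=> g0 gain.
have [ab abE] : {ab : Pi -> 'cV[R]_n * 'cV[R]_n & forall p, ok p ->
    P p *m (ab p).1 = (ab p).1 /\ r p = (ab p).1 + (ab p).2 - P p *m (ab p).2}.
  apply: (@choice _ _ (fun p (ab : 'cV[R]_n * 'cV[R]_n) => ok p ->
    P p *m ab.1 = ab.1 /\ r p = ab.1 + ab.2 - P p *m ab.2)) => p.
  have [okp|] := boolP (ok p); last by exists (0, 0).
  by have [a [b [? ?]]] := ergodic_decomposition (sP okp) (r p); exists (a, b).
(* [C] bounds the biases of all policies at once, since [t] must be fixed before the optimal policy
   for the discount factor [1 - t] is known. *)
pose C := \sum_p \sum_k `|(ab p).2 k 0|.
have C0 : 0 <= C by apply: sumr_ge0 => p _; apply: sumr_ge0.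
have bC p k : `|(ab p).2 k 0| <= C.
  rewrite /C (bigD1 p) //= (bigD1 k) //= -addrA lerDl addr_ge0 //.
    exact: sumr_ge0.
  by apply: sumr_ge0 => q _; apply: sumr_ge0.
(* Chosen so that the error [2 * C * t] is at most [g / 2]; the summand [g] keeps the denominator
   positive when [C = 0]. *)
pose t := g / (4 * C + g).
have d0 : 0 < 4 * C + g by rewrite ltr_wpDl // mulr_ge0.
have t0 : 0 < t by rewrite divr_gt0.
have t1 : t <= 1 by rewrite ler_pdivrMr // mul1r lerDr mulr_ge0.
have tC : 2 * C * t <= g / 2.
  have : t * (4 * C + g) = g by rewrite mulfVK // gt_eqF.
  have : 0 <= t * g by rewrite mulr_ge0 // ltW.
  lra.
have a0 : 0 <= 1 - t by rewrite subr_ge0.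
have a1 : 1 - t < 1 by rewrite gtrDl oppr_lt0.
have [p [x [okp xE xopt]]] := discounted_optimality a0 a1.
(* Since [t * x >= g - 2 * C * t >= g / 2], the vector [(1 - t) x] lies at least [g / 2] below
   [x]. *)
exists ((1 - t) *: x) => q okq k.
rewrite -scalemxAr; apply: le_trans (xopt _ okq k).
have [Pa rE] := abE _ okp.
have := discounted_lower_bound (sP okp) a0 a1 Pa rE (bC p) xE k.
have := gain _ okp _ _ Pa rE k.
rewrite mxE; lra.
Qed.

End Optimality.

(** * Payoff of a pair of stationary policies *)

Section FfunCons.
Context {T : finType}.

Definition fcons N (x : T) (f : {ffun 'I_N -> T}) : {ffun 'I_N.+1 -> T} :=
  [ffun i => oapp f x (unlift ord0 i)].

Lemma fcons0 N x (f : {ffun 'I_N -> T}) : fcons x f ord0 = x.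
Proof. by rewrite ffunE unlift_none. Qed.

Lemma fconsS N x (f : {ffun 'I_N -> T}) i : fcons x f (lift ord0 i) = f i.
Proof. by rewrite ffunE liftK. Qed.

Lemma sum_fcons (R : realType) N (F : {ffun 'I_N.+1 -> T} -> R) :
  \sum_f F f = \sum_x \sum_f F (fcons x f).
Proof.
rewrite pair_big /= (reindex (fun p : T * {ffun 'I_N -> T} => fcons p.1 p.2)) //.
exists (fun f : {ffun 'I_N.+1 -> T} =>
  (f ord0, [ffun i : 'I_N => f (lift ord0 i)])) => [[x f]|f] _ /=.
  by rewrite fcons0; congr pair; apply/ffunP => i; rewrite ffunE fconsS.
apply/ffunP => i; have [j|] := unliftP ord0 i => ->; last by rewrite fcons0.
by rewrite fconsS ffunE.
Qed.

End FfunCons.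

Section Chain.
Context {R : realType} {n m : nat} (G : game R n m).
Variables (sigma : 'I_n -> {set 'I_m}) (tau : 'I_m -> {set 'I_n}).

Definition step_prob (k : 'I_n) (i : 'I_m) (l : 'I_n) : R :=
  (i \in sigma k)%:R / #|sigma k|%:R * (tau i == [set l]%SET)%:R.

(** Summing out the state of Max contracts a full turn into one step of a Markov chain on the states
    of Min. *)
Definition chain_mx : 'M[R]_n := \matrix_(k, l) \sum_i step_prob k i l.

Definition chain_payment : 'cV[R]_n :=
  \col_k \sum_i (i \in sigma k)%:R / #|sigma k|%:R *
    (minr G k (sigma k) + maxr G i (tau i)).

Definition traj_mean N (H : {ffun 'I_N.+1 -> 'I_n} -> {ffun 'I_N -> 'I_m} -> R)
    (k : 'I_n) : R :=
  \sum_ks \sum_js traj_prob sigma tau k ks js * H ks js.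

Lemma turnS N (p : 'I_N) : turn (lift ord0 p) = lift ord0 (turn p).
Proof. exact: val_inj. Qed.

Lemma turn0 N : turn (ord0 : 'I_N.+1) = ord0.
Proof. exact: val_inj. Qed.

Lemma traj_prob_fcons k N k0 i (ks : {ffun 'I_N.+1 -> 'I_n}) js :
  traj_prob sigma tau k (fcons k0 ks) (fcons i js) =
  (k0 == k)%:R * (step_prob k0 i (ks ord0) *
    traj_prob sigma tau (ks ord0) ks js) :> R.
Proof.
rewrite /traj_prob big_ord_recl turn0 !fcons0 fconsS eqxx mul1r; congr (_ * (_ * _)).
by apply: eq_bigr => p _; rewrite turnS !fconsS.
Qed.

Lemma traj_payment_fcons N k i (ks : {ffun 'I_N.+1 -> 'I_n}) js :
  traj_payment G sigma tau (fcons k ks) (fcons i js) =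
  minr G k (sigma k) + maxr G i (tau i) + traj_payment G sigma tau ks js.
Proof.
rewrite /traj_payment big_ord_recl turn0 !fcons0; congr (_ + _).
by apply: eq_bigr => p _; rewrite turnS !fconsS.
Qed.

(** Markov property: given the first turn, the rest is a trajectory from the state [l] that was
    reached. *)
Lemma traj_meanS N H (k : 'I_n) :
  @traj_mean N.+1 H k = \sum_i \sum_l step_prob k i l *
    traj_mean (fun ks js => H (fcons k ks) (fcons i js)) l.
Proof.
rewrite /traj_mean sum_fcons (bigD1 k) //= [X in _ + X]big1 ?addr0; last first.
  move=> k0 k0k; apply: big1 => ks _; rewrite sum_fcons.
  apply: big1 => i _; apply: big1 => js _.
  by rewrite traj_prob_fcons (negPf k0k) !mul0r.
under eq_bigr do rewrite sum_fcons.
rewrite exchange_big /=; apply: eq_bigr => i _.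
under [RHS]eq_bigr do rewrite mulr_sumr.
rewrite [RHS]exchange_big /=; apply: eq_bigr => ks _.
(* Only [l = ks ord0] contributes: a trajectory from [l] must start at [l]. *)
rewrite [RHS](bigD1 (ks ord0)) //= [X in _ = _ + X]big1 ?addr0; last first.
  move=> l lk; rewrite big1 ?mulr0 // => js _.
  by rewrite /traj_prob eq_sym (negPf lk) !mul0r.
rewrite mulr_sumr; apply: eq_bigr => js _.
by rewrite traj_prob_fcons eqxx mul1r mulrA.
Qed.

Hypotheses (okS : min_policy G sigma) (okT : max_policy G tau).

Lemma sum_step_prob k i :
  \sum_l step_prob k i l = (i \in sigma k)%:R / #|sigma k|%:R.
Proof.
rewrite -mulr_sumr; have /eqP/cards1P[l ->] := maxB_card (okT i).
rewrite (bigD1 l) //= eqxx big1 ?addr0 ?mulr1 // => l' l'l.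
by rewrite (inj_eq set1_inj) eq_sym (negPf l'l).
Qed.

Lemma sum_min_prob k : \sum_i (i \in sigma k)%:R / #|sigma k|%:R = 1 :> R.
Proof.
rewrite -mulr_suml -natr_sum.
have -> : (\sum_i (i \in sigma k) = #|sigma k|)%N.
  by rewrite -sum1_card [RHS]big_mkcond; apply: eq_bigr => i _; case: (i \in _).
by rewrite mulfV // pnatr_eq0; have [->|->] := minA_card (okS k).
Qed.

Lemma chain_mx_stochastic : stochastic chain_mx.
Proof.
split=> [k l|k]; first by rewrite mxE sumr_ge0 // => i _; rewrite !mulr_ge0.
under eq_bigr do rewrite mxE.
by rewrite exchange_big; under eq_bigr do rewrite sum_step_prob; apply: sum_min_prob.
Qed.

(** Total mass 1 lets the payment of the first turn leave the expectation in [traj_mean_payment]. *)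
Lemma traj_mean1 N k : @traj_mean N (fun _ _ => 1) k = 1.
Proof.
elim: N k => [|N IH] k.
  rewrite /traj_mean sum_fcons (bigD1 k) //= [X in _ + X]big1 ?addr0; last first.
    move=> l lk; apply: big1 => ks _; apply: big1 => js _.
    by rewrite /traj_prob fcons0 (negPf lk) !mul0r.
  under eq_bigr do under eq_bigr do
    rewrite /traj_prob fcons0 eqxx big_ord0 !mulr1.
  under eq_bigr do rewrite sumr_const card_ffun !card_ord expn0 mulr1n.
  by rewrite sumr_const card_ffun !card_ord expn0 mulr1n.
rewrite traj_meanS -[RHS](sum_min_prob k); apply: eq_bigr => i _.
by rewrite -sum_step_prob; apply: eq_bigr => l _; rewrite IH mulr1.
Qed.

Definition total_payment N : 'cV[R]_n :=
  iter N (fun s => chain_payment + chain_mx *m s) 0.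

Lemma traj_mean_payment N k :
  traj_mean (@traj_payment _ _ _ G sigma tau N) k = total_payment N k 0.
Proof.
elim: N k => [|N IH] k.
  rewrite /traj_mean mxE; apply: big1 => ks _; apply: big1 => js _.
  by rewrite /traj_payment big_ord0 mulr0.
rewrite traj_meanS /= !mxE.
under eq_bigr => i _.
  under eq_bigr => l _.
    rewrite (_ : traj_mean _ _ =
      minr G k (sigma k) + maxr G i (tau i) + total_payment N l 0); last first.
      rewrite -IH -[X in X + _]mulr1 -(traj_mean1 N l) /traj_mean mulr_sumr.
      rewrite -big_split /=; apply: eq_bigr => ks _.
      rewrite mulr_sumr -big_split /=; apply: eq_bigr => js _.
      by rewrite traj_payment_fcons mulr1 mulrDr [in RHS]mulrC.
    rewrite mulrDr.
    over.
  rewrite big_split -mulr_suml sum_step_prob /=.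
  over.
rewrite big_split /=; congr (_ + _); rewrite exchange_big /=.
by apply: eq_bigr => l _; rewrite mxE mulr_suml.
Qed.

Lemma mean_paymentE k N :
  mean_payment G sigma tau k N = (2 * N%:R)^-1 * total_payment N k 0.
Proof.
rewrite -traj_mean_payment /mean_payment /traj_mean mulr_sumr.
apply: eq_bigr => ks _; rewrite mulr_sumr; apply: eq_bigr => js _.
by rewrite mulrCA.
Qed.

(** The terms [b - P b] of successive turns telescope to [b - P^N b], while [a], being fixed by [P],
    adds up. *)
Lemma total_payment_decomposition (a b : 'cV[R]_n) N :
  chain_mx *m a = a -> chain_payment = a + b - chain_mx *m b ->
  total_payment N = a *+ N + b - iter N (mulmx chain_mx) b.
Proof.
move=> Pa rE; elim: N => [|N IH]; first by rewrite mulr0n add0r subrr.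
rewrite /total_payment iterS -/(total_payment N) IH rE mulmxBr mulmxDr.
rewrite -scaler_nat -scalemxAr Pa scaler_nat mulrSr iterS.
apply/matrixP => i j; rewrite (ord1 j).
move: (iter N _ b) => c; move: (chain_mx *m c) (chain_mx *m b) => d e.
rewrite !mxE; ring.
Qed.

(** Division by [2 N] leaves [a / 2] in the limit, because [b - P^N b] stays bounded. *)
Lemma payoffE (a b : 'cV[R]_n) k :
  chain_mx *m a = a -> chain_payment = a + b - chain_mx *m b ->
  payoff G sigma tau k = a k 0 / 2.
Proof.
move=> Pa rE; apply: cvg_lim => //.
pose D := \sum_l `|b l 0|.
have bD l : `|b l 0| <= D by exact: col_normW.
(* Shifted to [N.+1] to avoid the division by zero at [N = 0]; [harmonic N] is [1 / (N + 1)]. *)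
have meanE N : mean_payment G sigma tau k N.+1 = a k 0 / 2 +
    (b k 0 - iter N.+1 (mulmx chain_mx) b k 0) / 2 * harmonic N.
  rewrite mean_paymentE (total_payment_decomposition _ Pa rE).
  move: (iter N.+1 _ b) => c; rewrite !mxE mulmxnE /= -(mulr_natr (a k 0)).
  by field; rewrite addrC natr1 pnatr_eq0.
have bound N : `|(b k 0 - iter N.+1 (mulmx chain_mx) b k 0) / 2| <= D.
  have := stochastic_iter_norm chain_mx_stochastic N.+1 bD k.
  have := bD k; rewrite !ler_norml; lra.
have lim0 (c : R) : (a k 0 / 2 + c * harmonic N @[N --> \oo] --> a k 0 / 2)%classic.
  rewrite -[in X in cvg_to _ X](addr0 (a k 0 / 2)) -[in X in cvg_to _ X](mulr0 c).
  apply: cvgD; first exact: cvg_cst.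
  by apply: cvgMr; apply: cvg_harmonic.
rewrite -cvg_shiftS; apply: (squeeze_cvgr _ (lim0 (- D)) (lim0 D)).
apply: nearW => N /=; rewrite meanE !lerD2l.
have := bound N; rewrite ler_norml => /andP[? ?].
by rewrite !ler_wpM2r //= invr_ge0.
Qed.

End Chain.

(** * The Shapley operator *)

Lemma bigmax_fin_num (R : realType) (I : finType) (P : pred I) (F : I -> \bar R) :
  (exists i, P i) -> (forall i, P i -> F i \is a fin_num) ->
  \big[Order.max/-oo%E]_(i | P i) F i \is a fin_num.
Proof.
move=> [i0 Pi0] Ffin; rewrite (Order.TotalTheory.bigmax_eq_arg _ _ _ _ Pi0) //.
  by case: arg_maxP => // i Pi _; apply: Ffin.
by move=> i _; apply: leNye.
Qed.

Lemma bigmin_fin_num (R : realType) (I : finType) (P : pred I) (F : I -> \bar R) :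
  (exists i, P i) -> (forall i, P i -> F i \is a fin_num) ->
  \big[Order.min/+oo%E]_(i | P i) F i \is a fin_num.
Proof.
move=> [i0 Pi0] Ffin; rewrite (bigmin_eq_arg _ _ _ _ Pi0) //.
  by case: arg_minP => // i Pi _; apply: Ffin.
by move=> i _; apply: leey.
Qed.

Section Shapley.
Context {R : realType} {n m : nat} (G : game R n m).
Implicit Types x y : 'I_n -> \bar R.

(** [best] and [pair_value] name the local pieces of [shapley], which agrees with them by
    conversion. *)
Definition best x (i : 'I_m) : \bar R :=
  \big[Order.max/-oo%E]_(l < n | [set l]%SET \in maxB G i)
    ((maxr G i [set l]%SET)%:E + x l)%E.

Definition pair_value x (k : 'I_n) (ij : 'I_m * 'I_m) : \bar R :=
  ((minr G k [set ij.1; ij.2]%SET)%:E +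
   (2^-1)%:E * (best x ij.1 + best x ij.2))%E.

(* Unqualified, [minA] is the associativity of [Order.min]. *)
Lemma shapleyE x k : shapley G x k =
  \big[Order.min/+oo%E]_(ij | [set ij.1; ij.2]%SET \in Defs.minA G k) pair_value x k ij.
Proof. by []. Qed.

Lemma minA_pair k a : a \in Defs.minA G k -> exists i j, a = [set i; j]%SET.
Proof.
move=> /minA_card[/eqP/cards1P[i ->]|/eqP/cards2P[i [j [_ ->]]]].
  by exists i, i; rewrite finset.setUid.
by exists i, j.
Qed.

Lemma le_best x y i : (forall k, x k <= y k)%E -> (best x i <= best y i)%E.
Proof. by move=> xy; apply: le_bigmax2 => l _; apply: leeD2l. Qed.

Lemma le_shapley x y : (forall k, x k <= y k)%E ->
  forall k, (shapley G x k <= shapley G y k)%E.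
Proof.
move=> xy k; rewrite !shapleyE; apply: le_bigmin2 => ij _; apply: leeD2l.
by apply: lee_wpmul2l; [rewrite lee_fin invr_ge0|apply: leeD; apply: le_best].
Qed.

Lemma best_translate x (c : R) i :
  (best (fun k => x k + c%:E) i <= best x i + c%:E)%E.
Proof.
apply: bigmax_le => [|l lB]; first exact: leNye.
rewrite addeA; apply: leeD2r.
pose F l := ((maxr G i [set l]%SET)%:E + x l)%E.
exact: (@Order.TotalTheory.le_bigmax_cond _ _ _ -oo%E l _ F lB).
Qed.

Lemma shapley_translate x (c : R) k :
  (shapley G (fun l => x l + c%:E) k <= shapley G x k + c%:E)%E.
Proof.
rewrite -leeBlDr // [leRHS]shapleyE; apply: le_bigmin => [|ij ijA]; first exact: leey.
rewrite leeBlDr // shapleyE.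
apply: le_trans (bigmin_le_cond _ (pair_value _ k) ijA) _.
rewrite /= -addeA; apply: leeD2l.
have -> : ((2^-1)%:E * (best x ij.1 + best x ij.2) + c%:E =
    (2^-1)%:E * ((best x ij.1 + c%:E) + (best x ij.2 + c%:E)))%E.
  rewrite addeACA -EFinD [in RHS]muleDr // ?fin_num_adde_defl // -EFinM.
  by congr (_ + _%:E)%E; field.
by apply: lee_wpmul2l; [rewrite lee_fin invr_ge0|apply: leeD; apply: best_translate].
Qed.

(** This is [shapley_translate] for the shifted vector and the constant [- c]. *)
Lemma shapley_translate_ge x (c : R) k :
  (shapley G x k + c%:E <= shapley G (fun l => x l + c%:E) k)%E.
Proof.
rewrite -leeBrDr // -EFinN; apply: le_trans (shapley_translate _ _ _).
by apply: le_shapley => l; rewrite -addeA -EFinD subrr adde0.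
Qed.

Lemma shapley_fin_num x k : (forall l, x l \is a fin_num) ->
  shapley G x k \is a fin_num.
Proof.
move=> xfin; rewrite shapleyE; apply: bigmin_fin_num.
  have /set0Pn[a aA] := minA_neq0 G k; have [i [j aE]] := minA_pair aA.
  by exists (i, j); rewrite /= -aE.
have bfin i : best x i \is a fin_num.
  apply: bigmax_fin_num => [|l _]; last by rewrite fin_numD xfin.
  have /set0Pn[b bB] := maxB_neq0 G i.
  by have /eqP/cards1P[l bE] := maxB_card bB; exists l; rewrite -bE.
by move=> ij _; rewrite fin_numD fin_numM // fin_numD !bfin.
Qed.

End Shapley.

(** * Drift of the Shapley operator *)

Section Drift.
Context {R : realType} {n m : nat} (G : game R n m).
Implicit Types y : 'cV[R]_n.

(** The average over [a] is written as in [traj_prob], to match the chain; [turn_value_pair]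
    converts it to the form found in [shapley], including the case [i = j]. *)
Definition turn_value (k : 'I_n) (a : {set 'I_m}) (f : 'I_m -> R) : R :=
  \sum_i (i \in a)%:R / #|a|%:R * (minr G k a + f i).

Definition action_value y (i : 'I_m) (b : {set 'I_n}) : R :=
  maxr G i b + \sum_l (b == [set l]%SET)%:R * y l 0.

Lemma turn_value_pair k i j f :
  turn_value k [set i; j]%SET f = minr G k [set i; j]%SET + 2^-1 * (f i + f j).
Proof.
rewrite /turn_value; set c := minr _ _ _.
have -> (a : {set 'I_m}) : \sum_i (i \in a)%:R / #|a|%:R * (c + f i) =
    #|a|%:R^-1 * \sum_(i in a) (c + f i).
  rewrite mulr_sumr [RHS]big_mkcond; apply: eq_bigr => l _.
  by case: (l \in a); rewrite ?mul0r ?mul1r.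
have [<-|ij] := eqVneq i j.
  by rewrite finset.setUid cards1 big_set1; field.
by rewrite cards2 ij big_setU1 ?inE //= big_set1; field.
Qed.

Lemma action_value1 y i l :
  action_value y i [set l]%SET = maxr G i [set l]%SET + y l 0.
Proof.
rewrite /action_value (bigD1 l) //= eqxx mul1r big1 ?addr0 // => l' l'l.
by rewrite (inj_eq set1_inj) eq_sym (negPf l'l) mul0r.
Qed.

Lemma chain_stepE sigma tau y k :
  (chain_payment G sigma tau + chain_mx sigma tau *m y) k 0 =
  turn_value k (sigma k) (fun i => action_value y i (tau i)).
Proof.
rewrite !mxE; under [X in _ + X]eq_bigr do rewrite mxE mulr_suml.
rewrite exchange_big -big_split; apply: eq_bigr => i _ /=.
rewrite /action_value addrA [in RHS]mulrDr; congr (_ + _).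
by rewrite mulr_sumr; apply: eq_bigr => l _; rewrite [RHS]mulrA.
Qed.

Lemma turn_value_le k a f g : (forall i, f i <= g i) ->
  turn_value k a f <= turn_value k a g.
Proof.
by move=> fg; apply: ler_sum => i _; rewrite ler_wpM2l ?lerD2l.
Qed.

Lemma best_ge y i b : b \in maxB G i ->
  ((action_value y i b)%:E <= best G (fun k => (y k 0)%:E) i)%E.
Proof.
move=> bB; have /eqP/cards1P[l bE] := maxB_card bB; rewrite bE in bB *.
rewrite action_value1 EFinD.
pose F l := ((maxr G i [set l]%SET)%:E + (y l 0)%:E)%E.
exact: (@Order.TotalTheory.le_bigmax_cond _ _ _ -oo%E l _ F bB).
Qed.

Lemma best_le y i c : (forall b, b \in maxB G i -> action_value y i b <= c) ->
  (best G (fun k => (y k 0)%:E) i <= c%:E)%E.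
Proof.
move=> Bc; apply: bigmax_le => [|l lB]; first exact: leNye.
by rewrite -EFinD lee_fin -action_value1 Bc.
Qed.

(** Committing Max to [tau] can only lower the Shapley operator. *)
Lemma shapley_ge tau y k c : max_policy G tau ->
  (forall a, a \in Defs.minA G k ->
     c <= turn_value k a (fun i => action_value y i (tau i))) ->
  (c%:E <= shapley G (fun k => (y k 0)%:E) k)%E.
Proof.
move=> okT Ac; rewrite shapleyE; apply: le_bigmin => [|[i j] ijA]; first exact: leey.
have := Ac _ ijA; rewrite /= turn_value_pair -lee_fin => /le_trans; apply.
rewrite EFinD EFinM EFinD; apply: leeD2l.
by apply: lee_wpmul2l; [rewrite lee_fin invr_ge0|apply: leeD; apply: best_ge].
Qed.

(** Committing Min to [sigma] can only raise the Shapley operator; [f] is any upper bound on the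
    options of Max. *)
Lemma shapley_le sigma y k (f : 'I_m -> R) : min_policy G sigma ->
  (forall i b, b \in maxB G i -> action_value y i b <= f i) ->
  (shapley G (fun k => (y k 0)%:E) k <= (turn_value k (sigma k) f)%:E)%E.
Proof.
move=> okS Bf; have [i [j aE]] := minA_pair (okS k).
have ijA : [set (i, j).1; (i, j).2]%SET \in Defs.minA G k by rewrite /= -aE.
rewrite shapleyE; apply: le_trans (bigmin_le_cond _ (pair_value _ _ k) ijA) _.
rewrite aE turn_value_pair EFinD EFinM EFinD; apply: leeD2l.
apply: lee_wpmul2l; first by rewrite lee_fin invr_ge0.
by apply: leeD; apply: best_le => b; apply: Bf.
Qed.

(** Against the fixed [tau], Min faces a one-player problem. Payoffs are [a / 2], so
    [a >= 2 * lambda] for every policy, and [uniform_drift] keeps half of this bound. *)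
Lemma shapley_drift_up (lambda : R) tau : 0 < lambda -> max_policy G tau ->
  (forall k sigma, min_policy G sigma -> lambda <= payoff G sigma tau k) ->
  exists y, forall k,
    ((y k 0 + lambda)%:E <= shapley G (fun l => (y l 0)%:E) k)%E.
Proof.
move=> l0 okT ge_lambda.
(* Policies are taken as finite functions so that they form a finite type, as [uniform_drift]
   requires. *)
pose ok := [pred s : {ffun 'I_n -> {set 'I_m}} | [forall k, s k \in Defs.minA G k]].
have greedy y : exists2 s, ok s & forall k a, a \in Defs.minA G k ->
    turn_value k (s k) (fun i => action_value y i (tau i)) <=
    turn_value k a (fun i => action_value y i (tau i)).
  pose v k a := turn_value k a (fun i => action_value y i (tau i)).
  have /(@choice _ _ _)[s sP] : forall k, exists a, a \in Defs.minA G k /\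
      forall a', a' \in Defs.minA G k -> v k a <= v k a'.
    move=> k; have /set0Pn[a0 a0A] := minA_neq0 G k.
    by case: (arg_minP (v k) a0A) => a aA amin; exists a; split.
  exists [ffun k => s k] => [|k a aA]; last by rewrite ffunE; apply: (sP k).2.
  by apply/forallP => k; rewrite ffunE; apply: (sP k).1.
have okP (s : {ffun 'I_n -> {set 'I_m}}) : ok s -> min_policy G s.
  by move=> /forallP.
have [||||y yP] := @uniform_drift _ _ _ ok (fun s => chain_payment G s tau)
    (fun s => chain_mx s tau) _ _ (2 * lambda).
- by move=> s /okP okS; apply: chain_mx_stochastic.
- move=> y; have [s oks sP] := greedy y; exists s => // s' /okP oks' k.
  by rewrite !chain_stepE; apply: sP.
- by rewrite mulr_gt0.
- move=> s /okP okS a b Pa rE k; have := ge_lambda k _ okS.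
  rewrite (payoffE okS okT k Pa rE); lra.
exists y => k; apply: (shapley_ge okT) => a aA.
have [s /forallP oks _] := greedy 0.
(* The inequality at [k] depends on the policy only through its action at [k], so any [a] is tested
   by placing it in an admissible [s]. *)
have := yP [ffun l => if l == k then a else s l] _ k.
rewrite chain_stepE ffunE eqxx mulrC mulKf // => -> //.
by apply/forallP => l; rewrite ffunE; case: eqP => [->|_].
Qed.

(** Payments and the vector change sign, which turns the problem of Max into a minimization. *)
Lemma shapley_drift_down (lambda : R) sigma : lambda < 0 -> min_policy G sigma ->
  (forall k tau, max_policy G tau -> payoff G sigma tau k <= lambda) ->
  exists y, forall k,
    (shapley G (fun l => (y l 0)%:E) k <= (y k 0 + lambda)%:E)%E.
Proof.
move=> l0 okS le_lambda.
pose ok := [pred t : {ffun 'I_m -> {set 'I_n}} | [forall i, t i \in maxB G i]].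
have greedy y : exists2 t, ok t & forall i b, b \in maxB G i ->
    action_value y i b <= action_value y i (t i).
  have /(@choice _ _ _)[t tP] : forall i, exists b, b \in maxB G i /\
      forall b', b' \in maxB G i -> action_value y i b' <= action_value y i b.
    move=> i; have /set0Pn[b0 b0B] := maxB_neq0 G i.
    by case: (arg_maxP (action_value y i) b0B) => b bB bmax; exists b; split.
  exists [ffun i => t i] => [|i b bB]; last by rewrite ffunE; apply: (tP i).2.
  by apply/forallP => i; rewrite ffunE; apply: (tP i).1.
have okP (t : {ffun 'I_m -> {set 'I_n}}) : ok t -> max_policy G t.
  by move=> /forallP.
have negE t y k : (- chain_payment G sigma t + chain_mx sigma t *m y) k 0 =
    - turn_value k (sigma k) (fun i => action_value (- y) i (t i)).
  rewrite -chain_stepE mulmxN; move: (chain_mx _ _ *m y) => z.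
  by rewrite !mxE; ring.
have [||||y yP] := @uniform_drift _ _ _ ok (fun t => - chain_payment G sigma t)
    (fun t => chain_mx sigma t) _ _ (- (2 * lambda)).
- by move=> t /okP okT; apply: chain_mx_stochastic.
- move=> y; have [t okt tP] := greedy (- y); exists t => // t' /forallP okt' k.
  by rewrite !negE lerN2; apply: turn_value_le => i; apply: tP.
- by rewrite oppr_gt0 pmulr_rlt0.
- move=> t /okP okT a b Pa rE k; have := le_lambda k _ okT.
  rewrite (@payoffE _ _ _ _ _ _ okS okT (- a) (- b)) ?mulmxN ?Pa //.
    by rewrite mxE; lra.
  by rewrite -[LHS]opprK rE !opprD.
(* A single policy suffices here: [t] attains the best action at every state of Max at once. *)
exists (- y) => k; have [t okt tP] := greedy (- y).
apply: le_trans (shapley_le k okS tP) _; rewrite lee_fin.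
have := yP _ okt k; rewrite negE mxE; lra.
Qed.

End Drift.

(** * Iterates of the Shapley operator *)

Lemma while_iterP (S : Type) (guard : S -> bool) (body : S -> S) s s' :
  while guard body s s' -> ~~ guard s' /\ exists N, s' = iter N body s.
Proof.
elim=> [{}s gs|{}s {}s' gs _ [gs' [N sE]]]; split=> //; first by exists 0%N.
by exists N.+1; rewrite iterSr.
Qed.

Lemma while_terminates (S : Type) (guard : S -> bool) (body : S -> S) N s :
  ~~ guard (iter N body s) -> exists s', while guard body s s'.
Proof.
elim: N s => [|N IH] s gs; first by exists s; apply: while_stop.
have [g|ng] := boolP (guard s); last by exists s; apply: while_stop.
move: gs; rewrite iterSr => /IH[s' ss'].
by exists s'; apply: while_next.
Qed.

Lemma archimedean_multiple (R : realType) (d C : R) : 0 < d ->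
  exists N, C <= d *+ N.
Proof.
move=> d0; exists (Num.truncn (C / d)).+1.
by rewrite -mulr_natr -ler_pdivrMl // mulrC ltW // truncnS_gt.
Qed.

Section Iteration.
Context {R : realType} {n m : nat} (G : game R n m).
Implicit Types (x : 'I_n -> \bar R) (y : 'cV[R]_n).
Let F := shapley G.
Let u N := iter N F (fun=> 0%E).

(** The vector [y - C] starts below [u 0 = 0]; monotonicity and translation preserve the comparison
    at each iteration, with a gain of [d]. *)
Lemma iter_shapley_up y (d C : R) :
  (forall k, ((y k 0 + d)%:E <= F (fun l => (y l 0)%:E) k)%E) ->
  (forall k, y k 0 <= C) ->
  forall N k, ((y k 0 - C + d *+ N)%:E <= u N k)%E.
Proof.
move=> yd yC; elim=> [|N IH] k; first by rewrite addr0 lee_fin subr_le0.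
rewrite /u iterS; apply: le_trans (le_shapley G IH k).
have -> : (fun l => (y l 0 - C + d *+ N)%:E) =
    (fun l => (y l 0)%:E + (d *+ N - C)%:E)%E.
  by apply/funext => l; rewrite -EFinD addrAC addrA.
apply: le_trans (shapley_translate_ge G _ _ k).
apply: le_trans (leeD2r _ (yd k)).
by rewrite -EFinD lee_fin mulrS; lra.
Qed.

Lemma iter_shapley_down y (d C : R) :
  (forall k, (F (fun l => (y l 0)%:E) k <= (y k 0 + d)%:E)%E) ->
  (forall k, - C <= y k 0) ->
  forall N k, (u N k <= (y k 0 + C + d *+ N)%:E)%E.
Proof.
move=> yd yC; elim=> [|N IH] k; first by rewrite addr0 lee_fin -lerBlDr sub0r.
rewrite /u iterS; apply: le_trans (le_shapley G IH k) _.
have -> : (fun l => (y l 0 + C + d *+ N)%:E) =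
    (fun l => (y l 0)%:E + (d *+ N + C)%:E)%E.
  by apply/funext => l; rewrite -EFinD addrAC addrA.
apply: le_trans (shapley_translate G _ _ k) _.
apply: le_trans (leeD2r _ (yd k)) _.
by rewrite -EFinD lee_fin mulrS; lra.
Qed.

Lemma iter_shapley_eventually_ge (d eps : R) y : 0 < d ->
  (forall k, ((y k 0 + d)%:E <= F (fun l => (y l 0)%:E) k)%E) ->
  exists N, forall k, (eps%:E <= u N k)%E.
Proof.
move=> d0 yd; pose C := \sum_l `|y l 0|.
(* The entries of [y - C] are at least [- 2 * C], so a total gain of [eps + 2 * C] is enough. *)
have [N NC] := archimedean_multiple (eps + C + C) d0.
have yC k : `|y k 0| <= C by exact: col_normW.
exists N => k; apply: le_trans (iter_shapley_up yd (C := C) _ N k).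
  by have := yC k; rewrite ler_norml lee_fin; lra.
by move=> l; have := yC l; rewrite ler_norml => /andP[].
Qed.

Lemma iter_shapley_eventually_le (d eps : R) y : d < 0 ->
  (forall k, (F (fun l => (y l 0)%:E) k <= (y k 0 + d)%:E)%E) ->
  exists N, forall k, (u N k <= (- eps)%:E)%E.
Proof.
move=> d0 yd; pose C := \sum_l `|y l 0|.
have [N NC] := @archimedean_multiple _ (- d) (eps + C + C) (ltac:(lra)).
have yC k : `|y k 0| <= C by exact: col_normW.
exists N => k; apply: le_trans (iter_shapley_down yd (C := C) _ N k) _.
  by move=> l; have := yC l; rewrite ler_norml => /andP[].
by move: NC; have := yC k; rewrite mulNrn ler_norml lee_fin; lra.
Qed.

Lemma subfixed_le_iter x (M : R) : (forall k, x k <= F x k)%E ->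
  (forall k, x k <= M%:E)%E -> forall N k, (x k <= u N k + M%:E)%E.
Proof.
move=> xF xM; elim=> [|N IH] k; first by rewrite add0e.
apply: le_trans (xF k) _; apply: le_trans (le_shapley G IH k) _.
exact: shapley_translate.
Qed.

Lemma no_subfixed_point N (eps : R) : 0 < eps ->
  (forall k, (u N k <= (- eps)%:E)%E) ->
  ~ exists x, [/\ in_Tn x, x <> (fun=> -oo%E) & forall k, (x k <= F x k)%E].
Proof.
move=> eps0 uN [x [xT xN xF]]; apply: xN; apply/funext => k0.
apply/eqP; apply: contraT => xk0.
case: (@arg_maxP _ _ _ k0 xpredT x isT) => k _ xk_max.
have kmax l : (x l <= x k)%E by apply: xk_max.
(* The largest entry is not [+oo] by [in_Tn], nor [-oo] because it dominates [x k0]. *)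
have xkfin : x k \is a fin_num.
  rewrite fin_numE xT andbT; apply: contra xk0 => /eqP xk.
  by have := kmax k0; rewrite xk leeNy_eq.
have xM l : (x l <= (fine (x k))%:E)%E by rewrite fineK // kmax.
have := subfixed_le_iter xF xM N k.
move=> /le_trans/(_ (leeD2r _ (uN k))); rewrite -EFinD -[x k]fineK // lee_fin.
by rewrite leNgt gtrDr oppr_lt0 eps0.
Qed.

(** The loop body verbatim, so that the general facts on [while] apply to it without rewriting. *)
Let state N := iter N
  (fun uv : ('I_n -> \bar R) * ('I_n -> \bar R) =>
     (F uv.1, fun k => Order.max (uv.2 k) (uv.1 k) : \bar R))
  (fun=> 0%E, fun=> 0%E).

Lemma state1 N : (state N).1 = u N.
Proof. by elim: N => [//|N IH]; rewrite /state iterS /= -/(state N) IH. Qed.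

Lemma u_fin_num N k : u N k \is a fin_num.
Proof. by elim: N k => [//|N IH] k; apply: shapley_fin_num. Qed.

(* The maximum with 0 is needed only because [u 0 = 0] is not of the form
   [F _]; it is harmless once [u N] is positive. *)
Lemma state2 N (v := (state N).2) k :
  [/\ v k \is a fin_num, (v k <= Order.max 0 (F v k))%E &
      (u N k <= Order.max 0 (F v k))%E].
Proof.
rewrite {}/v; elim: N k => [|N IH] k; first by split; rewrite // le_max lexx.
set v := (state N).2 in IH.
have vE : (state N.+1).2 = fun l => Order.max (v l) (u N l).
  by rewrite /state iterS -/(state N) state1.
have Fv l : (F v l <= F (state N.+1).2 l)%E.
  by apply: le_shapley => i; rewrite vE le_max lexx.
have le0F l : (Order.max 0 (F v l) <= Order.max 0 (F (state N.+1).2 l))%E.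
  by rewrite ge_max !le_max lexx Fv orbT.
have [vfin v_le u_le] := IH k; split.
- by rewrite vE; case: leP => _ //; apply: u_fin_num.
- rewrite {1}vE ge_max; apply/andP; split; exact: le_trans (le0F k).
(* [u N.+1] is [F (u N)], and the updated [v] dominates [u N]. *)
- rewrite le_max; apply/orP; right; apply: le_shapley => l.
  by rewrite vE le_max lexx orbT.
Qed.

(** Since [u N] is positive, the maximum with 0 in [state2] must be attained by [F v]. *)
Lemma state_subfixed N (eps : R) : 0 < eps ->
  (forall k, (eps%:E <= u N k)%E) -> forall k,
  (state N).2 k \is a fin_num /\ ((state N).2 k <= F (state N).2 k)%E.
Proof.
move=> eps0 uN k; have [vfin v_le u_le] := state2 N k; split=> //.
have : (0 < Order.max 0 (F (state N).2 k))%E.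
  by apply: lt_le_trans u_le; apply: lt_le_trans (uN k); rewrite lte_fin.
rewrite lt_max ltxx /= => /ltW F0.
by apply: le_trans v_le _; rewrite ge_max F0 lexx.
Qed.

End Iteration.

(** * Termination and correctness of the procedure *)

Theorem theorem41 (R : realType) (n m : nat) (G : game R n m)
    (chi : 'I_n -> R) (lambda : R)
    (hchi : is_value G chi) (hconst : forall k, chi k = lambda)
    (hlambda : lambda <> 0) (eps : R) (heps : 0 < eps) :
  (exists uv, CheckFeasibility (shapley G) eps uv) /\
  (forall u v : 'I_n -> \bar R, CheckFeasibility (shapley G) eps (u, v) ->
     ((vmax u <= (- eps)%:E)%E ->
        ~ exists x : 'I_n -> \bar R,
            [/\ in_Tn x, x <> (fun=> -oo%E) &
                forall k, (x k <= shapley G x k)%E]) /\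
     (~ (vmax u <= (- eps)%:E)%E ->
        forall k, v k \is a fin_num /\ (v k <= shapley G v k)%E)).
Proof.
have [sigma [tau [okS okT opt]]] := hchi.
have le_lambda k t : max_policy G t -> payoff G sigma t k <= lambda.
  by move=> okt; rewrite -(hconst k); apply: (opt k _ _ okS okt).1.
have ge_lambda k s : min_policy G s -> lambda <= payoff G s tau k.
  by move=> oks; rewrite -(hconst k); apply: (opt k _ _ oks okT).2.
have vmaxP (x : 'I_n -> \bar R) c : (vmax x <= c)%E <-> forall k, (x k <= c)%E.
  split=> [xc k|xc]; first exact: le_trans (Order.TotalTheory.le_bigmax _ _ _) xc.
  by apply: bigmax_le => [|k _]; first exact: leNye.
have vminP (x : 'I_n -> \bar R) c : (c <= vmin x)%E <-> forall k, (c <= x k)%E.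
  split=> [xc k|xc]; first exact: le_trans xc (bigmin_le _ _ _).
  by apply: le_bigmin => [|k _]; first exact: leey.
split.
  have [l0|l0|//] := ltgtP lambda 0.
  - have [y yd] := shapley_drift_down l0 okS le_lambda.
    have [N uN] := iter_shapley_eventually_le eps l0 yd.
    apply: (while_terminates (N := N)).
    by rewrite state1 negb_and -leNgt; apply/orP; left; apply/vmaxP.
  - have [y yd] := shapley_drift_up l0 okT ge_lambda.
    have [N uN] := iter_shapley_eventually_ge eps l0 yd.
    apply: (while_terminates (N := N)).
    by rewrite state1 negb_and -!leNgt; apply/orP; right; apply/vminP.
move=> u v check; have [guardF [N uvE]] := while_iterP check.
have uE : u = iter N (shapley G) (fun=> 0%E) by rewrite -state1 -uvE.
split=> [/vmaxP uN|uN].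
  by apply: (@no_subfixed_point _ _ _ _ N eps heps) => k; rewrite -uE.
have -> : v = (u, v).2 by [].
rewrite uvE; apply: (state_subfixed heps) => k; rewrite -uE.
(* The guard has failed, so once [vmax u <= - eps] is excluded only [vmin u >= eps] remains. *)
by move: guardF k; rewrite negb_and -!leNgt => /orP[/uN //|/vminP].
Qed.
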